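(* Let $n,j\in\mathbb{N}$ and let $K_1,\dots,K_j\in\mathcal{K}^n$. Then $$\mathrm{R}(K_1)+\cdots+\mathrm{R}(K_j)\ \le\ \sqrt{j}\;\mathrm{R}(K_1+\cdots+K_j).$$ Moreover, equality holds if $K_k$ and $K_l$ are contained in orthogonal linear subspaces for every choice $1\le k<l\le j$, and $\mathrm{R}(K_1)=\cdots=\mathrm{R}(K_j)$.
   Context: $\mathcal{K}^n$ denotes the set of (nonempty) convex and compact subsets of $\mathbb{R}^n$; they may be lower-dimensional. $K+L=\{x+y:x\in K,\,y\in L\}$ is the Minkowski sum. $\mathrm{R}(K)$ is the Euclidean circumradius: $\mathrm{R}(K)=\min\{\lambda\ge 0: K\subset x+\lambda\mathbb{B}^n_2\text{ for some }x\in\mathbb{R}^n\}$, where $\mathbb{B}^n_2=\{x\in\mathbb{R}^n:\|x\|_2\le 1\}$ is the Euclidean unit ball. *)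

(* Defs.v *)
From mathcomp Require Import all_boot all_order all_algebra.
From mathcomp Require Import all_classical all_reals all_analysis.

Set Implicit Arguments.
Unset Strict Implicit.
Unset Printing Implicit Defensive.

Import Order.TTheory GRing.Theory Num.Theory.
Import numFieldNormedType.Exports.

Local Open Scope classical_set_scope.
Local Open Scope ring_scope.

(* R^n is 'rV[R]_n.  The library's norm `|x| on 'rV[R]_n is the sup norm, so the
   Euclidean structure is introduced here; the library's topology on 'rV[R]_n is
   the usual one, so `compact` needs no change. *)
Definition dot (R : realType) (n : nat) (x y : 'rV[R]_n) : R :=
  \sum_(i < n) x ord0 i * y ord0 i.

Definition enorm (R : realType) (n : nat) (x : 'rV[R]_n) : R :=
  Num.sqrt (dot x x).

Definition unit_ball (R : realType) (n : nat) : set 'rV[R]_n :=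
  [set x | enorm x <= 1].

Definition convex_body (R : realType) (n : nat) (K : set 'rV[R]_n) : Prop :=
  [/\ K !=set0, convex_set K & compact K].

Definition minkowski_add (R : realType) (n : nat) (K L : set 'rV[R]_n) :
  set 'rV[R]_n := [set x + y | x in K & y in L].

(* The empty sum is [set 0], the neutral element of minkowski_add. *)
Definition minkowski_sum (R : realType) (n j : nat)
    (K : 'I_j -> set 'rV[R]_n) : set 'rV[R]_n :=
  \big[@minkowski_add R n/[set 0]]_(i < j) K i.

(* For K nonempty and compact the infimum is a minimum. *)
Definition circumradius (R : realType) (n : nat) (K : set 'rV[R]_n) : R :=
  inf [set r : R | 0 <= r /\
    exists x : 'rV[R]_n, K `<=` [set x + r *: b | b in @unit_ball R n]].

Definition orthogonal_subspaces (R : realType) (n : nat)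
    (U V : {vspace 'rV[R]_n}) : Prop :=
  forall u v : 'rV[R]_n, u \in U -> v \in V -> dot u v = 0.

Definition in_orthogonal_subspaces (R : realType) (n : nat)
    (K L : set 'rV[R]_n) : Prop :=
  exists U V : {vspace 'rV[R]_n},
    [/\ orthogonal_subspaces U V, K `<=` [set` U] & L `<=` [set` V]].

(* Main.v *)
(* If c is the circumcenter of K then, by strong convexity of
   w |-> max_(x in K) |x - w|^2, every w satisfies
   max_(x in K) |x - w|^2 >= R(K)^2 + |w - c|^2. With w = z - y, y in L, this
   gives R(K + L)^2 >= R(K)^2 + R(L)^2; induction on the number of summands and
   Cauchy-Schwarz yield the inequality. For K in a subspace U orthogonal to L,
   combining the U-part of a center of K with the orthogonal part of a center
   of L gives R(K + L)^2 <= R(K)^2 + R(L)^2. *)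
Require Import Defs.
From HB Require Import structures.
From mathcomp Require Import all_boot all_order all_algebra.
From mathcomp Require Import all_classical all_reals all_analysis.
From mathcomp Require Import ring lra.
Import Order.TTheory GRing.Theory Num.Theory.
Import numFieldNormedType.Exports.
Local Open Scope classical_set_scope.
Local Open Scope ring_scope.

(** * The Euclidean inner product and orthogonal decomposition *)

Section EuclideanSpace.
Context {R : realType} {n : nat}.
Implicit Types (x y z : 'rV[R]_n) (a t : R).

Lemma dotC x y : dot x y = dot y x.
Proof. by apply: eq_bigr => i _; rewrite mulrC. Qed.

Lemma dotDl x y z : dot (x + y) z = dot x z + dot y z.
Proof. by rewrite -big_split; apply: eq_bigr => i _; rewrite mxE mulrDl. Qed.

Lemma dotDr x y z : dot z (x + y) = dot z x + dot z y.
Proof. by rewrite ![dot z _]dotC dotDl. Qed.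

Lemma dotZl a x y : dot (a *: x) y = a * dot x y.
Proof. by rewrite mulr_sumr; apply: eq_bigr => i _; rewrite mxE mulrA. Qed.

Lemma dotZr a x y : dot x (a *: y) = a * dot x y.
Proof. by rewrite ![dot x _]dotC dotZl. Qed.

Lemma dot0r x : dot x 0 = 0.
Proof. by rewrite -(scale0r x) dotZr mul0r. Qed.

Lemma dot_suml (I : Type) (r : seq I) (P : pred I) (F : I -> 'rV[R]_n) y :
  dot (\sum_(i <- r | P i) F i) y = \sum_(i <- r | P i) dot (F i) y.
Proof.
apply: (big_morph (fun x => dot x y)); first by move=> ? ?; exact: dotDl.
by rewrite dotC dot0r.
Qed.

Lemma dot_ge0 x : 0 <= dot x x.
Proof. by apply: sumr_ge0 => i _; rewrite -expr2 sqr_ge0. Qed.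

Lemma dot_eq0 x : dot x x = 0 -> x = 0.
Proof.
move=> /psumr_eq0P x0; apply/rowP => i; rewrite mxE.
have /eqP := x0 (fun i _ => sqr_ge0 (x ord0 i)) i isT.
by rewrite mulf_eq0 orbb => /eqP.
Qed.

Lemma dotN x : dot (- x) (- x) = dot x x.
Proof. by apply: eq_bigr => i _; rewrite mxE mulrNN. Qed.

Lemma dot_pythagoras x y : dot x y = 0 ->
  dot (x + y) (x + y) = dot x x + dot y y.
Proof. by move=> xy; rewrite dotDl !dotDr (dotC y x) xy addr0 add0r. Qed.

Lemma dotD_le x y : dot (x + y) (x + y) <= 2 * dot x x + 2 * dot y y.
Proof.
rewrite !mulr_sumr -big_split; apply: ler_sum => i _; rewrite !mxE /=.
have := sqr_ge0 (x ord0 i - y ord0 i); lra.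
Qed.

(** Stewart's identity, a polynomial identity in each coordinate. For [0 < t < 1] its last term is
    the strong convexity gain. *)
Lemma dot_convex_comb t x y z :
  dot (x - ((1 - t) *: y + t *: z)) (x - ((1 - t) *: y + t *: z)) =
  (1 - t) * dot (x - y) (x - y) + t * dot (x - z) (x - z)
    - t * (1 - t) * dot (z - y) (z - y).
Proof.
rewrite !mulr_sumr -big_split -sumrB /=.
by apply: eq_bigr => i _; rewrite !mxE; ring.
Qed.

(** The orthogonal complement of [U] is the kernel of the map [g] taking inner products with a basis
    of [U]. It meets [U] trivially by definiteness, and a dimension count shows that both span the
    space. *)
Lemma orthogonal_decomposition (U : {vspace 'rV[R]_n}) x :
  exists u v : 'rV[R]_n, [/\ x = u + v, u \in U & forall w, w \in U -> dot w v = 0].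
Proof.
pose f y := \row_(i < \dim U) dot (vbasis U)`_i y.
have f_lin : linear f.
  by move=> a y z; apply/rowP => i; rewrite !mxE dotDr dotZr.
pose fL : {linear 'rV[R]_n -> 'rV[R]_(\dim U)} :=
  HB.pack f (GRing.isLinear.Build _ _ _ _ f f_lin).
pose g := linfun fL.
have ker_orth v : v \in lker g -> forall w, w \in U -> dot w v = 0.
  rewrite memv_ker lfunE /= => /eqP/rowP fv0 w wU.
  rewrite (coord_vbasis wU) dot_suml big1 // => i _.
  by have := fv0 i; rewrite !mxE dotZl => ->; rewrite mulr0.
have cap0 : (U :&: lker g = 0)%VS.
  apply/eqP; rewrite -subv0; apply/subvP => w; rewrite memv_cap => /andP[wU wk].
  by rewrite memv0; apply/eqP/dot_eq0/(ker_orth w wk).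
have : x \in (U + lker g)%VS.
  suff -> : (U + lker g)%VS = fullv by exact: memvf.
  apply/eqP; rewrite eqEdim subvf /= dimv_disjoint_sum //.
  (* By rank-nullity it remains to bound the rank of [g] by [\dim U], the length of its values. *)
  rewrite -(limg_ker_dim g fullv) capfv addnC leq_add2r.
  by have := dimvS (subvf (limg g)); rewrite dimvf /dim /= mul1n.
move=> /memv_addP[u uU [v vk ->]]; exists u, v; split => //.
exact: ker_orth.
Qed.

End EuclideanSpace.

(** * Circumradius and the Minkowski sum of two sets *)

Section Circumradius.
Context {R : realType} {n : nat}.
Implicit Types (K L : set 'rV[R]_n) (c x y : 'rV[R]_n) (r s : R).

(** Here [s] is a squared radius, so that estimates on centers stay polynomial. *)
Definition circumscribed K c s := forall x, K x -> dot (x - c) (x - c) <= s.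

Lemma circumscribed_ge0 K c s : K !=set0 -> circumscribed K c s -> 0 <= s.
Proof. by move=> [x Kx] /(_ x Kx); apply: le_trans (dot_ge0 _). Qed.

Lemma subset_ballP K c r : 0 <= r ->
  (K `<=` [set c + r *: b | b in @unit_ball R n]) <->
  circumscribed K c (r ^+ 2).
Proof.
move=> r0; split=> [sub x /sub[b]|cK x Kx].
  rewrite /unit_ball /= /enorm -[X in _ <= X]sqrtr1 ler_sqrt // => b1 <-.
  rewrite addrAC subrr add0r dotZl dotZr mulrA -expr2.
  by rewrite ler_piMr // sqr_ge0.
have [r_eq0|r_neq0] := eqVneq r 0.
  have xc : x - c = 0.
    apply/dot_eq0/eqP; rewrite eq_le dot_ge0 andbT.
    by have := cK x Kx; rewrite r_eq0 expr0n.
  exists 0; first by rewrite /unit_ball /= /enorm dot0r sqrtr0 ler01.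
  by rewrite scaler0 addr0 -[RHS](subrK c) xc add0r.
exists (r^-1 *: (x - c)); last by rewrite scalerA divff // scale1r addrC subrK.
rewrite /unit_ball /= /enorm -[X in _ <= X]sqrtr1 ler_sqrt //.
rewrite dotZl dotZr mulrA -expr2 exprVn ler_pdivrMl ?mulr1 ?cK //.
by rewrite exprn_gt0 // lt_def r_neq0.
Qed.

Lemma circumradius_ge0 K : 0 <= circumradius K.
Proof.
rewrite /circumradius; set A := (X in inf X).
(* A set that no ball encloses gets circumradius [0], the value of [inf] at the empty set. *)
have [->|/set0P A0] := eqVneq A set0; first by rewrite inf0.
by apply: lb_le_inf => // r [].
Qed.

Lemma circumradius_sqr_le K c s : K !=set0 -> circumscribed K c s ->
  circumradius K ^+ 2 <= s.
Proof.
move=> K0 cK; have s0 := circumscribed_ge0 _ _ _ K0 cK.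
rewrite -(sqr_sqrtr s0) lerXn2r ?nnegrE ?sqrtr_ge0 ?circumradius_ge0 //.
apply: ge_inf; first by exists 0 => r [].
split; first exact: sqrtr_ge0.
by exists c; apply/subset_ballP; rewrite ?sqrtr_ge0 ?sqr_sqrtr.
Qed.

Definition bounded_from K := exists c s, circumscribed K c s.

(** Boundedness makes the set of admissible radii nonempty, so some admissible radius lies below the
    square root of [circumradius K ^+ 2 + e], which exceeds the infimum. *)
Lemma near_circumcenter K (e : R) : 0 < e -> K !=set0 -> bounded_from K ->
  exists c, circumscribed K c (circumradius K ^+ 2 + e).
Proof.
move=> e0 K0 [c0 [s0 cK0]]; have s0_ge0 := circumscribed_ge0 _ _ _ K0 cK0.
have rad_ge0 := circumradius_ge0 K.
have rad_lt : circumradius K < Num.sqrt (circumradius K ^+ 2 + e).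
  rewrite -[ltLHS](ger0_norm rad_ge0) -sqrtr_sqr ltr_sqrt; last first.
    by rewrite ltr_wpDl ?sqr_ge0.
  by rewrite ltrDl.
have [|r [r0 [c /subset_ballP cK]] r_lt] := inf_lt _ rad_lt.
  exists (Num.sqrt s0); split; first exact: sqrtr_ge0.
  by exists c0; apply/subset_ballP; rewrite ?sqrtr_ge0 ?sqr_sqrtr.
exists c => x Kx; apply: le_trans (cK r0 x Kx) _.
rewrite -[leRHS]sqr_sqrtr; last by rewrite addr_ge0 ?sqr_ge0 ?ltW.
by rewrite lerXn2r ?nnegrE ?sqrtr_ge0 // ltW.
Qed.

Lemma compact_bounded_from K : compact K -> bounded_from K.
Proof.
move=> /compact_bounded [M [_ /(_ (M + 1))]].
rewrite ltrDl ltr01 => /(_ isT) KM.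
(* [M + 1] bounds the sup norm on [K], hence every coordinate. *)
exists 0, (\sum_(i < n) (M + 1) ^+ 2) => x Kx; rewrite subr0.
apply: ler_sum => i _; rewrite -expr2 -real_normK ?num_real //.
have xM : `|x ord0 i| <= M + 1.
  apply: le_trans (KM x Kx); rewrite [leRHS]/Num.norm /= mx_normrE.
  exact: (le_bigmax _ (fun ij => `|x ij.1 ij.2|) (ord0, i)).
by rewrite lerXn2r ?nnegrE // (le_trans _ xM).
Qed.

Lemma minkowski_add_nonempty K L :
  K !=set0 -> L !=set0 -> minkowski_add K L !=set0.
Proof. by move=> [x Kx] [y Ly]; exists (x + y), x => //; exists y. Qed.

Lemma minkowski_add_bounded K L :
  bounded_from K -> bounded_from L -> bounded_from (minkowski_add K L).
Proof.
move=> [c [s cK]] [d [t dL]]; exists (c + d), (2 * s + 2 * t).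
move=> _ [x Kx [y Ly <-]]; rewrite opprD addrACA.
apply: le_trans (dotD_le _ _) _.
by rewrite lerD // ler_wpM2l // ?cK ?dL.
Qed.

(* Near-minimal centers replace the circumcenter, so that its existence is not
   needed: c is minimal up to t^2, and t tends to 0. *)
Lemma circumscribed_minkowski_add K L z s :
  K !=set0 -> bounded_from K -> L !=set0 ->
  circumscribed (minkowski_add K L) z s ->
  circumradius K ^+ 2 + circumradius L ^+ 2 <= s.
Proof.
move=> K0 Kb L0 zKL; set k := circumradius K ^+ 2; set l := circumradius L ^+ 2.
have l0 : 0 <= l by exact: sqr_ge0.
have bound t : 0 < t -> t < 1 -> (1 - t) * l <= s - k + (1 - t) * t.
  move=> t0 t1; have t1' : 0 < 1 - t by rewrite subr_gt0.
  (* The slack is [t ^+ 2] because the estimate is later divided by [t]; the error [(1 - t) * t]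
     that remains still vanishes with [t]. *)
  have [c cK] := near_circumcenter K (t ^+ 2) (exprn_gt0 _ t0) K0 Kb.
  rewrite mulrC -ler_pdivlMr //.
  apply: (circumradius_sqr_le L (z - c)) => // y Ly.
  rewrite ler_pdivlMr //.
  pose w := z - y.
  (* Since [x - w = (x + y) - z], the point [w] is also a center for [K], with bound [s]. Testing
     [k] at a point between [c] and [w] bounds the distance from [w] to [c], which equals that from
     [y] to [z - c]. *)
  have : k <= (1 - t) * (k + t ^+ 2) + t * s - t * (1 - t) * dot (w - c) (w - c).
    apply: (circumradius_sqr_le K ((1 - t) *: c + t *: w)) => // x Kx.
    have xw : dot (x - w) (x - w) <= s.
      by rewrite /w opprB addrA; apply: zKL; exists x => //; exists y.
    rewrite dot_convex_comb; apply: lerB => //.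
    by apply: lerD; apply: ler_wpM2l => //; [exact: ltW | exact: cK | exact: ltW].
  rewrite (_ : dot (w - c) (w - c) = dot (y - (z - c)) (y - (z - c))).
    move=> h; rewrite -(ler_pM2l t0); lra.
  by rewrite -dotN; congr dot; apply/rowP => i; rewrite !mxE; ring.
apply/ler_addgt0Pr => e e0.
(* The total error in [bound] is [t * l + (1 - t) * t], at most [t * (1 + l)], which this choice
   keeps below [e]. *)
pose t := e / (1 + l + e).
have d0 : 0 < 1 + l + e by lra.
have t0 : 0 < t by rewrite divr_gt0.
have t1 : t < 1 by rewrite ltr_pdivrMr //; lra.
have te : t * (1 + l + e) = e by rewrite divfK // gt_eqF.
have := bound t t0 t1; nra.
Qed.

Lemma circumradius_minkowski_add_ge K L :
  K !=set0 -> bounded_from K -> L !=set0 -> bounded_from L ->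
  circumradius K ^+ 2 + circumradius L ^+ 2
    <= circumradius (minkowski_add K L) ^+ 2.
Proof.
move=> K0 Kb L0 Lb; apply/ler_addgt0Pr => e e0.
have [z zKL] := near_circumcenter _ _ e0 (minkowski_add_nonempty _ _ K0 L0)
  (minkowski_add_bounded _ _ Kb Lb).
exact: circumscribed_minkowski_add zKL.
Qed.

(** Orthogonality is stated between [U] and the points of [L], a form that passes to Minkowski sums
    in the second argument. *)
Lemma circumradius_orthogonal_add_le K L (U : {vspace 'rV[R]_n}) :
  K !=set0 -> bounded_from K -> L !=set0 -> bounded_from L ->
  K `<=` [set` U] -> (forall u y, u \in U -> L y -> dot u y = 0) ->
  circumradius (minkowski_add K L) ^+ 2
    <= circumradius K ^+ 2 + circumradius L ^+ 2.
Proof.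
move=> K0 Kb L0 Lb KU UL; apply/ler_addgt0Pr => e e0.
have e2 : 0 < e / 2 by rewrite divr_gt0.
have [c cK] := near_circumcenter _ _ e2 K0 Kb.
have [d dL] := near_circumcenter _ _ e2 L0 Lb.
have [cu [cv [cE cuU cvU]]] := orthogonal_decomposition U c.
have [du [dv [dE duU dvU]]] := orthogonal_decomposition U d.
(* Replacing [c] by [cu] and [d] by [dv] increases no distance to [K] or [L]: the discarded [cv] is
   orthogonal to [x - cu], and [du] to [y - dv]. *)
apply: (circumradius_sqr_le _ (cu + dv)); first exact: minkowski_add_nonempty.
move=> _ [x Kx [y Ly <-]]; rewrite opprD addrACA.
have xU : x - cu \in U by rewrite memvB // KU.
have ydv u : u \in U -> dot u (y - dv) = 0.
  by move=> uU; rewrite dotDr -scaleN1r dotZr UL // dvU // mulr0 addr0.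
rewrite dot_pythagoras; last exact: ydv.
have hx : dot (x - cu) (x - cu) <= circumradius K ^+ 2 + e / 2.
  apply: le_trans (cK x Kx); rewrite cE opprD addrA (dot_pythagoras (x - cu)).
    by rewrite lerDl dot_ge0.
  by rewrite -(scaleN1r cv) dotZr cvU // mulr0.
have hy : dot (y - dv) (y - dv) <= circumradius L ^+ 2 + e / 2.
  apply: le_trans (dL y Ly); rewrite dE opprD addrCA (dot_pythagoras (- du)).
    by rewrite lerDr dot_ge0.
  by rewrite ydv // memvN.
by rewrite [e]splitr addrACA lerD.
Qed.

End Circumradius.

(** * Minkowski sums of finitely many sets, by induction on their number *)

Section MinkowskiSum.
Context {R : realType} {n : nat}.

Lemma minkowski_sum0 (K : 'I_0 -> set 'rV[R]_n) : minkowski_sum K = [set 0].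
Proof. exact: big_ord0. Qed.

Lemma minkowski_sumS j (K : 'I_j.+1 -> set 'rV[R]_n) :
  minkowski_sum K =
  minkowski_add (K ord0) (minkowski_sum (fun i => K (lift ord0 i))).
Proof. exact: big_ord_recl. Qed.

Lemma minkowski_sum_nonempty j (K : 'I_j -> set 'rV[R]_n) :
  (forall i, K i !=set0) -> minkowski_sum K !=set0.
Proof.
elim: j K => [|j IHj] K K0; first by rewrite minkowski_sum0; exists 0.
by rewrite minkowski_sumS; apply: minkowski_add_nonempty => //; apply: IHj.
Qed.

Lemma minkowski_sum_bounded j (K : 'I_j -> set 'rV[R]_n) :
  (forall i, bounded_from (K i)) -> bounded_from (minkowski_sum K).
Proof.
elim: j K => [|j IHj] K Kb.
  by rewrite minkowski_sum0; exists 0, 0 => _ ->; rewrite subr0 dot0r.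
by rewrite minkowski_sumS; apply: minkowski_add_bounded => //; apply: IHj.
Qed.

Lemma dot_minkowski_sum j (K : 'I_j -> set 'rV[R]_n) u y :
  (forall i x, K i x -> dot u x = 0) -> minkowski_sum K y -> dot u y = 0.
Proof.
elim: j K y => [|j IHj] K y uK; first by rewrite minkowski_sum0 => ->; exact: dot0r.
rewrite minkowski_sumS => -[x Kx [z Kz <-]].
by rewrite dotDr (uK _ _ Kx) (IHj _ _ _ Kz) ?addr0 // => i ?; apply: uK.
Qed.

Lemma circumradius_singleton0 : circumradius [set (0 : 'rV[R]_n)] = 0.
Proof.
apply/eqP; rewrite -sqrf_eq0 eq_le sqr_ge0 andbT.
apply: (circumradius_sqr_le _ 0); first by exists 0.
by move=> _ ->; rewrite subr0 dot0r.
Qed.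

Lemma sum_circumradius_sqr_le j (K : 'I_j -> set 'rV[R]_n) :
  (forall i, K i !=set0) -> (forall i, bounded_from (K i)) ->
  \sum_(i < j) circumradius (K i) ^+ 2 <= circumradius (minkowski_sum K) ^+ 2.
Proof.
elim: j K => [|j IHj] K K0 Kb; first by rewrite big_ord0 sqr_ge0.
rewrite big_ord_recl minkowski_sumS.
apply: le_trans (circumradius_minkowski_add_ge _ _ _ _ _ _) => //.
- by rewrite lerD2l; apply: IHj.
- exact: minkowski_sum_nonempty.
- exact: minkowski_sum_bounded.
Qed.

Lemma circumradius_orthogonal_sum_sqr_le j (K : 'I_j -> set 'rV[R]_n) :
  (forall i, K i !=set0) -> (forall i, bounded_from (K i)) ->
  (forall k l : 'I_j, (k < l)%N -> in_orthogonal_subspaces (K k) (K l)) ->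
  circumradius (minkowski_sum K) ^+ 2 <= \sum_(i < j) circumradius (K i) ^+ 2.
Proof.
elim: j K => [|j IHj] K K0 Kb Korth.
  by rewrite minkowski_sum0 circumradius_singleton0 big_ord0 expr0n.
(* The subspace containing [K ord0] may vary with the other set of the pair; the intersection of all
   the [U i] contains [K ord0] and is orthogonal to every later set. *)
have /choice[U UK] (i : 'I_j) : exists U : {vspace 'rV[R]_n},
    K ord0 `<=` [set` U] /\
    forall u y, u \in U -> K (lift ord0 i) y -> dot u y = 0.
  have [U [V [UV KU KV]]] := Korth ord0 (lift ord0 i) isT.
  by exists U; split=> // u y uU /KV yV; apply: UV.
rewrite big_ord_recl minkowski_sumS.
apply: le_trans (circumradius_orthogonal_add_le _ _ (\bigcap_i U i)%VS
  _ _ _ _ _ _) _ => //.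
- exact: minkowski_sum_nonempty.
- exact: minkowski_sum_bounded.
- move=> x Kx /=; rewrite memvE; apply/subv_bigcapP => i _.
  by rewrite -memvE; apply: (UK i).1.
- move=> u y uU; apply: dot_minkowski_sum => i x; apply: (UK i).2.
  by move: uU; rewrite memvE => /subv_bigcapP /(_ i isT); rewrite -memvE.
by rewrite lerD2l; apply: IHj => // k l kl; apply: Korth; rewrite !lift0 ltnS.
Qed.

End MinkowskiSum.

(** Cauchy-Schwarz against the constant vector, in variance form: the squares of the [m * a i - S]
    add up to [m * (m * Q - S ^+ 2)], and [m > 0] can be cancelled once [j = 0] is set aside. *)
Lemma sqr_sum_le {R : realType} j (a : 'I_j -> R) :
  (\sum_(i < j) a i) ^+ 2 <= j%:R * \sum_(i < j) a i ^+ 2.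
Proof.
case: j a => [|j] a; first by rewrite !big_ord0 expr0n mul0r.
set m := j.+1%:R; have m0 : 0 < m :> R by rewrite ltr0n.
have expand (S : R) : \sum_(i < j.+1) (m * a i - S) ^+ 2 =
    m ^+ 2 * (\sum_(i < j.+1) a i ^+ 2) - 2 * m * S * (\sum_(i < j.+1) a i)
      + m * S ^+ 2.
  have -> : m * S ^+ 2 = \sum_(i < j.+1) S ^+ 2.
    by rewrite sumr_const card_ord mulr_natl.
  rewrite !mulr_sumr -sumrB -big_split; apply: eq_bigr => i _ /=; ring.
have := expand (\sum_(i < j.+1) a i); set S := \sum_(i < _) a i.
set Q := \sum_(i < _) a i ^+ 2 => E.
have : 0 <= m * (m * Q - S ^+ 2).
  rewrite (_ : _ * _ = \sum_(i < j.+1) (m * a i - S) ^+ 2); last by rewrite E; ring.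
  by apply: sumr_ge0 => i _; exact: sqr_ge0.
by rewrite pmulr_rge0 // subr_ge0.
Qed.

Theorem theorem1p2 (R : realType) (n j : nat) (K : 'I_j -> set 'rV[R]_n)
    (hK : forall i : 'I_j, convex_body (K i)) :
  (\sum_(i < j) circumradius (K i)
     <= Num.sqrt j%:R * circumradius (minkowski_sum K)) /\
  ((forall k l : 'I_j, (k < l)%N -> in_orthogonal_subspaces (K k) (K l)) ->
   (forall k l : 'I_j, circumradius (K k) = circumradius (K l)) ->
   \sum_(i < j) circumradius (K i)
     = Num.sqrt j%:R * circumradius (minkowski_sum K)).
Proof.
have K0 i : K i !=set0 by case: (hK i).
have Kb i : bounded_from (K i) by case: (hK i) => _ _ /compact_bounded_from.
have S0 : 0 <= \sum_(i < j) circumradius (K i).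
  by apply: sumr_ge0 => i _; exact: circumradius_ge0.
have rhs0 : 0 <= Num.sqrt j%:R * circumradius (minkowski_sum K).
  by rewrite mulr_ge0 ?sqrtr_ge0 ?circumradius_ge0.
have rhs_sqr : (Num.sqrt j%:R * circumradius (minkowski_sum K)) ^+ 2 =
    j%:R * circumradius (minkowski_sum K) ^+ 2.
  by rewrite exprMn sqr_sqrtr ?ler0n.
have sum_le := sum_circumradius_sqr_le _ K K0 Kb.
split=> [|Korth Keq].
  rewrite -(@ler_pXn2r _ 2) ?nnegrE // rhs_sqr.
  apply: le_trans (sqr_sum_le _ _) _; by rewrite ler_wpM2l ?ler0n.
apply/eqP; rewrite -(eqrXn2 (n := 2)) // rhs_sqr; apply/eqP.
(* Under orthogonality the squared circumradii add exactly. *)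
rewrite (_ : _ ^+ 2 = \sum_(i < j) circumradius (K i) ^+ 2); last first.
  by apply/eqP; rewrite eq_le sum_le circumradius_orthogonal_sum_sqr_le.
(* What remains is the equality case of Cauchy-Schwarz. The common radius is read off at [ord0], so
   the empty family is treated apart. *)
case: j K Keq {hK K0 Kb S0 rhs0 rhs_sqr sum_le Korth} => [|j] K Keq.
  by rewrite big_ord0 expr0n mul0r.
under eq_bigr do rewrite (Keq _ ord0).
under [in RHS]eq_bigr do rewrite (Keq _ ord0).
by rewrite !sumr_const card_ord exprMn_n mulr_natl -mulrnA mulnn.
Qed.
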